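(* Let $0<a<2/e$ and let $x$ solve $$x''(t)=x(t-a),\qquad t\ge0,$$ with strictly positive $C^1$ initial history on $[-a,0]$. Write $$c_0:=\frac{J_s[x](0)}{\Delta'(s)},\qquad c_1:=\frac{J_{-r}[x](0)}{\Delta'(-r)}.$$ Then $c_0=0$ and $c_1\ge0$ if and only if $$x(t)>0\quad\text{and}\quad x'(t)<0\qquad\text{for all }t\ge0.$$
   Context: Let $\Delta(\lambda)=\lambda^2-e^{-a\lambda}$. For $0<a<2/e$, $s$ denotes the positive real root of $\Delta$ and $-r$ its largest negative real root; thus $s^2=e^{-as}$, $r^2=e^{ar}$, $0<s<r<2/a$. For a characteristic root $\lambda$ (a zero of $\Delta$), $$J_\lambda[x](t):=x'(t)+\lambda x(t)+e^{-a\lambda}\int_{-a}^0e^{-\lambda\theta}x(t+\theta)\,d\theta .$$ The solution $x$ is $C^1$ on $[-a,\infty)$. *)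

(* Defs.v *)
From Stdlib Require Export Reals.
From Coquelicot Require Export Coquelicot.
Open Scope R_scope.

Definition char_fun (a lam : R) : R := lam ^ 2 - exp (- a * lam).

(* [D_in f d D t] is the derivative relative to the set [D], hence one-sided at
   an endpoint of an interval [D]. *)
Definition C1_on (D : R -> Prop) (f : R -> R) : Prop :=
  exists df : R -> R,
    forall t, D t -> D_in f df D t /\ continue_in df D t.

(* At [t = 0] the second derivative is the right derivative of [x'].  The total
   operator [Derive x] is only used on [0, +oo), which lies in the interior of
   the domain of [x] (for [0 < a]), so it is the derivative of [x] there. *)
Definition is_solution (a : R) (x : R -> R) : Prop :=
  C1_on (fun t => - a <= t) x /\
  forall t, 0 <= t ->
    D_in (Derive x) (fun u => x (u - a)) (fun u => 0 <= u) t.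

Definition is_positive_root (a s : R) : Prop := 0 < s /\ char_fun a s = 0.

Definition is_largest_negative_root (a rho : R) : Prop :=
  rho < 0 /\ char_fun a rho = 0 /\
  forall lam, lam < 0 -> char_fun a lam = 0 -> lam <= rho.

Definition J_fun (a lam : R) (x : R -> R) (t : R) : R :=
  Derive x t + lam * x t +
  exp (- a * lam) *
    RInt (fun theta => exp (- lam * theta) * x (t + theta)) (- a) 0.

(* Main.v *)
Require Import Defs.
From Stdlib Require Import Reals Lra.
From Coquelicot Require Import Coquelicot.
Open Scope R_scope.

(** Let [J] denote the functional attached to a characteristic root [lam].
    Along a solution [J] satisfies [J' = lam * J], so that
    [exp (- lam * t) * J t] is constant in [t >= 0]: this is [invariant] below,
    and its value at [0] is [J 0].

    The signs of [Derive (char_fun a)] at [s] and at [- r] (positive, and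
    negative because [a * r < 2]) turn [c0 = 0 /\ 0 <= c1] into
    [J_s = 0 /\ J_(-r) <= 0], where [J_s] and [J_(-r)] are the values at [0].

    Both conservation laws contain the velocity [x'] linearly.  When [J_s = 0],
    eliminating [x'] between them leaves, for [y t = exp (r * t) * x t], the
    renewal equation
      [(r + s) * y t = int_(t-a)^t K (t - u) * y u du - J_(-r)],
      [K v = r^2 - s^2 * exp ((r + s) * v)].
    The characteristic equations give [s^2 * exp ((r + s) * a) = r^2], hence
    [K > 0] on [[0, a)], and the integral of [K] over [[0, a]] equals
    [a * r^2 - r + s], which is less than [r + s] exactly because [a * r < 2]
    ([kernel_pos], [RInt_kernel], [renewal_equation]).

    If [J_(-r) <= 0], then at a first zero of [y] the right-hand side would still
    be positive: so [x] stays positive ([renewal_positive]), and [J_s = 0] writes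
    [x'] as minus a sum of positive terms.

    Conversely, let [x] be positive and decreasing.  If [J_s > 0], then [J] at
    time [t] grows like [exp (s * t)] although it is bounded above; if [J_s < 0],
    then [x'] stays below a negative constant and [x] reaches [0].  So [J_s = 0]
    ([invariant_zero_of_decreasing]) and the renewal equation holds.  If
    [J_(-r) > 0], its kernel of mass less than [r + s] and its negative forcing
    term push [y] down at least linearly, which contradicts [y > 0]
    ([renewal_not_positive]). *)

(** * Regularity of solutions *)

Lemma D_in_interior (D : R -> Prop) (f d : R -> R) (t : R) :
  locally t D -> D_in f d D t -> is_derive f t (d t).
Proof.
  intros [e He] H. apply is_derive_Reals. intros eps Heps.
  destruct (H eps Heps) as [al [Hal Hl]].
  assert (Hd : 0 < Rmin e al) by (apply Rmin_pos; [apply cond_pos | exact Hal]).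
  exists (mkposreal _ Hd). intros h Hh0 Hh. simpl in Hh.
  assert (Hhe : Rabs h < e) by (eapply Rlt_le_trans; [exact Hh | apply Rmin_l]).
  assert (Hha : Rabs h < al) by (eapply Rlt_le_trans; [exact Hh | apply Rmin_r]).
  specialize (Hl (t + h)). simpl in Hl. unfold Rdist in Hl.
  replace (t + h - t) with h in Hl by ring.
  apply Hl. repeat split; try assumption; try lra.
  apply He. change (Rabs (t + h - t) < e). now replace (t + h - t) with h by ring.
Qed.

Lemma continue_in_interior (D : R -> Prop) (f : R -> R) (t : R) :
  locally t D -> continue_in f D t -> continuous f t.
Proof.
  intros [e He] H. apply continuity_pt_filterlim. intros eps Heps.
  destruct (H eps Heps) as [al [Hal Hl]].
  exists (Rmin e al). split; [apply Rmin_pos; [apply cond_pos | exact Hal] |].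
  intros u [[_ Hne] Hu]. simpl in Hu. apply Hl. split.
  - split; [|exact Hne]. apply He. eapply Rlt_le_trans; [exact Hu | apply Rmin_l].
  - eapply Rlt_le_trans; [exact Hu | apply Rmin_r].
Qed.

(** Freezing [f] at its value at [b] to the left of [b] turns one-sided
    continuity at [b] into continuity. *)
Lemma continuous_clamp (b : R) (f : R -> R) :
  (forall t, b <= t -> continue_in f (fun u => b <= u) t) ->
  forall t, continuous (fun u => f (Rmax b u)) t.
Proof.
  intros H t. apply continuity_pt_filterlim. intros eps Heps.
  destruct (H (Rmax b t) (Rmax_l _ _) eps Heps) as [al [Hal Hl]].
  exists al. split; [exact Hal|]. intros u [_ Hu]. simpl in *. unfold Rdist in *.
  destruct (Req_dec (Rmax b t) (Rmax b u)) as [E|E].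
  - rewrite E, Rminus_diag, Rabs_R0. exact Heps.
  - apply Hl. split; [split; [apply Rmax_l | exact E] |].
    eapply Rle_lt_trans; [|exact Hu].
    unfold Rmax; repeat destruct Rle_dec; unfold Rabs; repeat destruct Rcase_abs; lra.
Qed.

(** The equation for a pair (position, velocity) defined on the whole line.  The
    position is required to be continuous everywhere so that its integrals over
    windows [[t - a, t]] are differentiable in [t] without boundary cases; the
    equation itself is asked only for [t > 0], continuity of [p] at [0] covering
    the endpoint. *)
Record delay_solution (a : R) (X p : R -> R) : Prop := {
  ds_continuous : forall t, continuous X t;
  ds_velocity_continuous : forall t, 0 <= t -> continuous p t;
  ds_velocity : forall t, 0 <= t -> is_derive X t (p t);
  ds_equation : forall t, 0 < t -> is_derive p t (X (t - a)) }.

Lemma delay_solution_clamp (a : R) (x : R -> R) :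
  0 < a -> is_solution a x ->
  delay_solution a (fun t => x (Rmax (- a) t)) (Derive x).
Proof.
  intros Ha [[df Hdf] Heq].
  assert (Hloc : forall c t, c < t -> locally t (fun u => c <= u)).
  { intros c t Hct. apply filter_imp with (fun u => c < u).
    - intros; lra.
    - now apply (open_gt c). }
  assert (Hder : forall t, - a < t -> is_derive x t (df t)).
  { intros t Ht. apply (D_in_interior (fun u => - a <= u)); [now apply Hloc|].
    apply Hdf; lra. }
  assert (Hcl : forall t, - a < t ->
            locally t (fun u => x u = x (Rmax (- a) u))).
  { intros t Ht. generalize (Hloc _ _ Ht). apply filter_imp. intros u Hu.
    now rewrite Rmax_right. }
  split.
  - apply continuous_clamp. intros t Ht. apply cont_deriv with (d := df). apply Hdf, Ht.
  - intros t Ht. apply continuous_ext_loc with df.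
    + assert (Ht' : - a < t) by lra.
      generalize (open_gt (- a) t Ht'). apply filter_imp. intros u Hu.
      symmetry. now apply is_derive_unique, Hder.
    + apply (continue_in_interior (fun u => - a <= u)); [apply Hloc; lra|].
      apply Hdf; lra.
  - intros t Ht. apply is_derive_ext_loc with x; [apply Hcl; lra|].
    apply Derive_correct. exists (df t). apply Hder; lra.
  - intros t Ht. rewrite Rmax_right by lra.
    apply (D_in_interior (fun u => 0 <= u) _ (fun u => x (u - a))); [now apply Hloc|].
    apply Heq; lra.
Qed.

(** * The conserved quantity of a characteristic root *)

Lemma ex_RInt_of_continuous (g : R -> R) (b c : R) :
  (forall u, continuous g u) -> ex_RInt g b c.
Proof. intros Hg. apply (ex_RInt_continuous (V := R_CompleteNormedModule)); auto. Qed.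

Lemma is_derive_RInt_window (a t : R) (g : R -> R) :
  (forall u, continuous g u) ->
  is_derive (fun v => RInt g (v - a) v) t (g t - g (t - a)).
Proof.
  intros Hg.
  evar_last.
  - apply (is_derive_RInt_bound_comp g (fun b c => RInt g b c) (fun v => v - a) (fun v => v) 1 1).
    + apply filter_forall. intros [b c].
      apply (RInt_correct (V := R_CompleteNormedModule) g b c), ex_RInt_of_continuous, Hg.
    + apply Hg.
    + apply Hg.
    + auto_derive; [trivial | ring].
    + auto_derive; [trivial | ring].
  - unfold minus, plus, opp, scal; simpl. unfold mult; simpl. ring.
Qed.

Lemma continuous_exp_weight (l : R) (X : R -> R) (u : R) :
  continuous X u -> continuous (fun v => exp (l * v) * X v) u.
Proof.
  intros H. apply (continuous_mult (fun v => exp (l * v)) X); [|exact H].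
  apply (ex_derive_continuous (V := R_NormedModule)). auto_derive. trivial.
Qed.

(** [exp (- lam * t)] times the functional [J_fun a lam X t], written with the
    integration variable shifted to the window [[t - a, t]], so that the integrand
    does not depend on [t]. *)
Definition invariant (a lam : R) (X p : R -> R) (t : R) : R :=
  exp (- lam * t) * (p t + lam * X t) +
  exp (- a * lam) * RInt (fun u => exp (- lam * u) * X u) (t - a) t.

(** The derivative is [exp (- lam * t)] times
    [X (t - a) - lam^2 * X t + exp (- a * lam) * X t - X (t - a)]: the delayed
    terms cancel identically, the others by the characteristic equation. *)
Lemma invariant_constant (a lam : R) (X p : R -> R) (t : R) :
  delay_solution a X p -> char_fun a lam = 0 -> 0 <= t ->
  invariant a lam X p t = invariant a lam X p 0.
Proof.
  intros [HX Hp HXp Hpp] Hroot Ht.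
  assert (Hl : exp (- a * lam) = lam ^ 2) by (unfold char_fun in Hroot; lra).
  set (W := fun v => RInt (fun u => exp (- lam * u) * X u) (v - a) v).
  assert (HW : forall v, is_derive W v
            (exp (- lam * v) * X v - exp (- lam * (v - a)) * X (v - a))).
  { intros v. apply (is_derive_RInt_window a v (fun u => exp (- lam * u) * X u)).
    intros u. apply continuous_exp_weight, HX. }
  destruct (MVT_gen (invariant a lam X p) 0 t (fun _ => 0)) as [c [_ Hc]].
  - rewrite Rmin_left, Rmax_right by lra. intros v [Hv _].
    change (is_derive (fun v => exp (- lam * v) * (p v + lam * X v)
              + exp (- a * lam) * W v) v 0).
    assert (HXv := HXp v (Rlt_le _ _ Hv)). assert (Hpv := Hpp v Hv).
    assert (HWv := HW v).
    auto_derive.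
    + repeat split; try trivial; eexists; eassumption.
    + change (fun u : R => X u) with X. change (fun u : R => p u) with p.
      change (fun u : R => W u) with W.
      rewrite (is_derive_unique _ _ _ HXv), (is_derive_unique _ _ _ Hpv),
        (is_derive_unique _ _ _ HWv).
      replace (exp (- lam * (v - a))) with (exp (- lam * v) / exp (- a * lam)).
      * rewrite Hl.
        assert (Hnz : lam ^ 2 <> 0) by (rewrite <- Hl; apply Rgt_not_eq, exp_pos).
        field. intros ->. apply Hnz. ring.
      * unfold Rdiv. rewrite <- exp_Ropp, <- exp_plus. f_equal. ring.
  - rewrite Rmin_left, Rmax_right by lra. intros v [Hv _].
    apply continuity_pt_filterlim.
    apply (continuous_plus (fun v => exp (- lam * v) * (p v + lam * X v))
             (fun v => exp (- a * lam) * W v)).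
    + apply (continuous_exp_weight (- lam) (fun v => p v + lam * X v)).
      apply (continuous_plus p (fun v => lam * X v)); [now apply Hp|].
      apply (continuous_mult (fun _ => lam) X); [apply continuous_const | apply HX].
    + apply (continuous_mult (fun _ => exp (- a * lam)) W); [apply continuous_const|].
      apply (ex_derive_continuous (V := R_NormedModule)). eexists. apply HW.
  - lra.
Qed.

(** The integral in [J_fun] at time [0] only sees the values of [x] on [[- a, 0]],
    where clamping changes nothing. *)
Lemma J_fun_invariant (a lam : R) (x : R -> R) :
  0 < a ->
  J_fun a lam x 0 = invariant a lam (fun t => x (Rmax (- a) t)) (Derive x) 0.
Proof.
  intros Ha. unfold J_fun, invariant.
  rewrite Rmult_0_r, exp_0, Rmult_1_l, Rmax_right by lra.
  rewrite Rminus_0_l. f_equal. f_equal.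
  apply RInt_ext. rewrite Rmin_left, Rmax_right by lra. intros u Hu.
  rewrite Rmax_right by lra. now rewrite Rplus_0_l.
Qed.

(** * Positivity in renewal equations *)

Lemma first_zero (f : R -> R) (t1 : R) :
  (forall u, continuous f u) -> 0 < f 0 -> 0 <= t1 -> f t1 <= 0 ->
  exists t0, 0 < t0 /\ f t0 = 0 /\ forall u, 0 <= u < t0 -> 0 < f u.
Proof.
  intros Hf H0 Ht1 Hf1.
  destruct (completeness (fun t => 0 <= t /\ forall u, 0 <= u <= t -> 0 < f u))
    as [t0 [Hub Hlub]].
  - exists t1. intros t [Ht Hpos].
    destruct (Rle_lt_dec t t1) as [|Hlt]; [assumption|].
    specialize (Hpos t1). lra.
  - exists 0. split; [lra|]. intros u Hu. replace u with 0 by lra. exact H0.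
  - assert (Hbelow : forall u, 0 <= u < t0 -> 0 < f u).
    { intros u Hu. apply Rnot_le_lt. intros Hfu.
      assert (t0 <= u); [|lra]. apply Hlub. intros t [Ht Hpos].
      destruct (Rle_lt_dec t u) as [|Hlt]; [assumption|].
      specialize (Hpos u). lra. }
    (* Used with [e = 1] and [e = -1]: the sign of [f] persists near [t0]. *)
    assert (Hsign : forall e, 0 < e * f t0 ->
              exists d, 0 < d /\ forall u, Rabs (u - t0) < d -> 0 < e * f u).
    { intros e He.
      assert (Hc : continuous (fun u => e * f u) t0)
        by (apply (continuous_mult (fun _ => e) f);
            [apply continuous_const | apply Hf]).
      destruct (Hc _ (open_gt 0 _ He)) as [d Hd].
      exists d. split; [apply cond_pos|]. exact Hd. }
    assert (Ht0 : 0 <= t0).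
    { apply Hub. split; [lra|]. intros u Hu. replace u with 0 by lra. exact H0. }
    assert (Hnpos : f t0 <= 0).
    { apply Rnot_lt_le. intros Hpos.
      destruct (Hsign 1) as [d [Hd Hnear]]; [lra|].
      assert (t0 + d / 2 <= t0); [|lra]. apply Hub. split; [lra|]. intros u Hu.
      destruct (Rlt_le_dec u t0) as [Hlt|Hge]; [now apply Hbelow|].
      rewrite <- Rmult_1_l. apply Hnear. rewrite Rabs_pos_eq; lra. }
    assert (Ht0' : 0 < t0).
    { destruct Ht0 as [|<-]; [assumption|lra]. }
    exists t0. split; [exact Ht0'|]. split; [|exact Hbelow].
    apply Rle_antisym; [exact Hnpos|]. apply Rnot_lt_le. intros Hneg.
    destruct (Hsign (-1)) as [d [Hd Hnear]]; [lra|].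
    assert (Hd' : 0 < Rmin d t0) by now apply Rmin_pos.
    pose proof (Rmin_l d t0). pose proof (Rmin_r d t0).
    assert (0 < f (t0 - Rmin d t0 / 2)) by (apply Hbelow; lra).
    assert (0 < -1 * f (t0 - Rmin d t0 / 2)); [|lra].
    apply Hnear. rewrite Rabs_left; lra.
Qed.

Lemma continuous_convolution_integrand (K y : R -> R) (t : R) :
  (forall u, continuous K u) -> (forall u, continuous y u) ->
  forall u, continuous (fun u => K (t - u) * y u) u.
Proof.
  intros HK Hy u. apply (continuous_mult (fun u => K (t - u)) y); [|apply Hy].
  apply (continuous_comp (fun u => t - u) K); [|apply HK].
  apply (ex_derive_continuous (V := R_NormedModule)). auto_derive. trivial.
Qed.

(** At a first zero [t0] of [y] the equation would read [0 = (positive integral) + c],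
    because [y] is still positive on the window [[t0 - a, t0)]. *)
Lemma renewal_positive (a m c : R) (K y : R -> R) :
  0 < a -> 0 <= c ->
  (forall u, continuous K u) -> (forall v, 0 < v < a -> 0 < K v) ->
  (forall u, continuous y u) -> (forall t, - a <= t <= 0 -> 0 < y t) ->
  (forall t, 0 <= t -> m * y t = RInt (fun u => K (t - u) * y u) (t - a) t + c) ->
  forall t, 0 <= t -> 0 < y t.
Proof.
  intros Ha Hc HK HKpos Hy Hy0 Hren t Ht. apply Rnot_le_lt. intros Hyt.
  destruct (first_zero y t) as [t0 [Ht0 [Hz Hpos]]]; auto; [apply Hy0; lra|].
  specialize (Hren t0 (Rlt_le _ _ Ht0)). rewrite Hz in Hren.
  assert (0 < RInt (fun u => K (t0 - u) * y u) (t0 - a) t0); [|lra].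
  apply RInt_gt_0; [lra| |intros; now apply continuous_convolution_integrand].
  intros u Hu. apply Rmult_lt_0_compat; [apply HKpos; lra|].
  destruct (Rle_lt_dec 0 u); [apply Hpos | apply Hy0]; lra.
Qed.

Lemma RInt_reflect (a t : R) (K : R -> R) :
  (forall u, continuous K u) ->
  RInt (fun u => K (t - u)) (t - a) t = RInt K 0 a.
Proof.
  intros HK.
  assert (H := RInt_comp_lin K (-1) t (t - a) t).
  replace (-1 * (t - a) + t) with a in H by ring.
  replace (-1 * t + t) with 0 in H by ring.
  specialize (H (ex_RInt_of_continuous K _ _ HK)).
  assert (Hscal : RInt (fun u => scal (-1) (K (-1 * u + t))) (t - a) t
                  = -1 * RInt (fun u => K (-1 * u + t)) (t - a) t).
  { apply (RInt_scal (fun u => K (-1 * u + t))).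
    apply ex_RInt_of_continuous. intros u.
    apply (continuous_comp (fun u => -1 * u + t) K); [|apply HK].
    apply (ex_derive_continuous (V := R_NormedModule)). auto_derive. trivial. }
  rewrite (RInt_ext _ (fun u => K (-1 * u + t))) by (intros; f_equal; ring).
  assert (Hswap : - RInt K a 0 = RInt K 0 a)
    by (apply (opp_RInt_swap K), ex_RInt_of_continuous, HK).
  change (@eq R (RInt (fun u => K (-1 * u + t)) (t - a) t) (RInt K 0 a)).
  assert (Hflip : RInt K a 0 = -1 * RInt (fun u => K (-1 * u + t)) (t - a) t)
    by exact (eq_trans (eq_sym H) Hscal).
  lra.
Qed.

(** A positive solution would satisfy [y t + e * t <= M] for all [t >= 0], where
    [M] is the maximum of [y] over [[- a, 0]], and so become negative at last.
    Indeed, at a maximum point [w > 0] of [y t + e * t] the values of [y] in the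
    window before [w] are at most [y w + e * a]; as [K] has mass at most [m], the
    equation gives [m * y w <= m * (y w + e * a) - c], which is false when
    [m * e * a < c]. *)
Lemma renewal_not_positive (a m c : R) (K y : R -> R) :
  0 < a -> 0 < m -> 0 < c ->
  (forall u, continuous K u) -> (forall v, 0 < v < a -> 0 <= K v) -> RInt K 0 a <= m ->
  (forall u, continuous y u) ->
  (forall t, 0 <= t -> m * y t = RInt (fun u => K (t - u) * y u) (t - a) t - c) ->
  ~ forall t, 0 <= t -> 0 < y t.
Proof.
  intros Ha Hm Hc HK HKpos HKm Hy Hren Hpos.
  (* Any slope [e] with [m * e * a < c] would do. *)
  set (e := c / (2 * m * a)).
  assert (He : 0 < e) by (apply Rdiv_lt_0_compat; [lra|]; repeat apply Rmult_lt_0_compat; lra).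
  assert (Hea : m * (e * a) = c / 2) by (unfold e; field; lra).
  destruct (continuity_ab_maj y (- a) 0) as [v [Hv _]];
    [lra | intros; apply continuity_pt_filterlim, Hy |].
  assert (HM : 0 < y v) by (apply Rlt_le_trans with (y 0); [apply Hpos | apply Hv]; lra).
  (* [t1] is the time at which the bound [y t + e * t <= y v] gives [y t <= 0]. *)
  set (t1 := y v / e).
  assert (Ht1 : 0 < t1) by now apply Rdiv_lt_0_compat.
  assert (Het1 : e * t1 = y v) by (unfold t1; field; lra).
  destruct (continuity_ab_maj (fun t => y t + e * t) (- a) t1) as [w [Hw Hwin]]; [lra| |].
  { intros u _. apply continuity_pt_filterlim.
    apply (continuous_plus y (fun t => e * t)); [apply Hy|].
    apply (ex_derive_continuous (V := R_NormedModule)). auto_derive. trivial. }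
  simpl in Hw. specialize (Hpos t1 (Rlt_le _ _ Ht1)) as Hyt1.
  destruct (Rle_lt_dec w 0) as [Hw0|Hw0].
  - specialize (Hv w ltac:(lra)). specialize (Hw t1 ltac:(lra)).
    assert (0 <= e * (- w)) by (apply Rmult_le_pos; lra). lra.
  - specialize (Hren w (Rlt_le _ _ Hw0)). assert (Hyw := Hpos w (Rlt_le _ _ Hw0)).
    assert (HA : 0 <= y w + e * a).
    { assert (0 < e * a) by now apply Rmult_lt_0_compat. lra. }
    assert (Hle : RInt (fun u => K (w - u) * y u) (w - a) w
                  <= RInt (fun u => (y w + e * a) * K (w - u)) (w - a) w).
    { apply RInt_le; [lra| | |].
      - apply ex_RInt_of_continuous. now apply continuous_convolution_integrand.
      - apply ex_RInt_of_continuous. intros u.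
        apply (continuous_ext (fun u => K (w - u) * (y w + e * a))); [intros; apply Rmult_comm|].
        apply (continuous_convolution_integrand K (fun _ => y w + e * a)); [exact HK|].
        intros; apply continuous_const.
      - intros u Hu. rewrite Rmult_comm. apply Rmult_le_compat_r; [apply HKpos; lra|].
        specialize (Hw u ltac:(lra)).
        assert (0 <= e * (a - (w - u))) by (apply Rmult_le_pos; lra). lra. }
    rewrite (RInt_scal (fun u => K (w - u))), RInt_reflect in Hle by first
      [ exact HK
      | apply ex_RInt_of_continuous; intros u;
        apply (continuous_ext (fun u => K (w - u) * 1)); [intros; apply Rmult_1_r|];
        apply (continuous_convolution_integrand K (fun _ => 1)); [exact HK|];
        intros; apply continuous_const ].
    unfold scal in Hle; simpl in Hle; unfold mult in Hle; simpl in Hle.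
    assert ((y w + e * a) * RInt K 0 a <= (y w + e * a) * m)
      by now apply Rmult_le_compat_l.
    lra.
Qed.

Lemma RInt_lin_comb (b c u v : R) (f g : R -> R) :
  (forall w, continuous f w) -> (forall w, continuous g w) ->
  RInt (fun w => b * f w - c * g w) u v = b * RInt f u v - c * RInt g u v.
Proof.
  intros Hf Hg. apply is_RInt_unique.
  apply (is_RInt_minus (fun w => b * f w) (fun w => c * g w)).
  - apply (is_RInt_scal f).
    apply (RInt_correct (V := R_CompleteNormedModule)), ex_RInt_of_continuous, Hf.
  - apply (is_RInt_scal g).
    apply (RInt_correct (V := R_CompleteNormedModule)), ex_RInt_of_continuous, Hg.
Qed.

(** * The renewal equation of the dominant decaying mode *)

Definition kernel (r s v : R) : R := r ^ 2 - s ^ 2 * exp ((r + s) * v).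

Lemma char_fun_root (a lam : R) : char_fun a lam = 0 -> exp (- a * lam) = lam ^ 2.
Proof. unfold char_fun. lra. Qed.

Lemma continuous_kernel (r s u : R) : continuous (kernel r s) u.
Proof.
  apply (ex_derive_continuous (V := R_NormedModule)). unfold kernel. auto_derive. trivial.
Qed.

(** The kernel vanishes at [v = a]: since [s^2 = exp (- a * s)] and
    [r^2 = exp (a * r)], both sides are [exp (a * r)]. *)
Lemma kernel_end (a r s : R) :
  char_fun a s = 0 -> char_fun a (- r) = 0 -> s ^ 2 * exp ((r + s) * a) = r ^ 2.
Proof.
  intros Hs Hr. apply char_fun_root in Hs, Hr.
  rewrite <- Hs, <- exp_plus. replace (r ^ 2) with ((- r) ^ 2) by ring.
  rewrite <- Hr. f_equal. ring.
Qed.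

(** [kernel r s] decreases strictly to its zero at [v = a]. *)
Lemma kernel_pos (a r s v : R) :
  0 < s -> 0 < r -> char_fun a s = 0 -> char_fun a (- r) = 0 -> v < a ->
  0 < kernel r s v.
Proof.
  intros Hs Hr Hcs Hcr Hv. unfold kernel. rewrite <- (kernel_end a r s Hcs Hcr).
  rewrite <- Rmult_minus_distr_l. apply Rmult_lt_0_compat; [now apply pow_lt|].
  apply Rlt_0_minus, exp_increasing, Rmult_lt_compat_l; lra.
Qed.

Lemma RInt_kernel (a r s : R) :
  0 < s -> 0 < r -> char_fun a s = 0 -> char_fun a (- r) = 0 ->
  RInt (kernel r s) 0 a = a * r ^ 2 - r + s.
Proof.
  intros Hs Hr Hcs Hcr.
  set (F := fun v => r ^ 2 * v - s ^ 2 / (r + s) * exp ((r + s) * v)).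
  replace (a * r ^ 2 - r + s) with (F a - F 0).
  - apply is_RInt_unique. apply (is_RInt_derive F (kernel r s)).
    + intros v _. unfold F, kernel. auto_derive; [trivial | field; lra].
    + intros v _. apply continuous_kernel.
  - unfold F. rewrite !Rmult_0_r, exp_0.
    replace (s ^ 2 / (r + s) * exp ((r + s) * a))
      with (s ^ 2 * exp ((r + s) * a) / (r + s)) by (field; lra).
    rewrite (kernel_end a r s Hcs Hcr). field. lra.
Qed.

(** The laws for [s] and [- r], multiplied by [exp ((r + s) * t)] and [1], carry the
    same factor [exp (r * t) * p t]; subtracting them eliminates the velocity. *)
Lemma renewal_equation (a r s : R) (X p : R -> R) (t : R) :
  delay_solution a X p -> char_fun a s = 0 -> char_fun a (- r) = 0 ->
  invariant a s X p 0 = 0 -> 0 <= t ->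
  (r + s) * (exp (r * t) * X t) =
  RInt (fun u => kernel r s (t - u) * (exp (r * u) * X u)) (t - a) t
  - invariant a (- r) X p 0.
Proof.
  intros Hsol Hs Hr Hinv Ht.
  rewrite <- (invariant_constant a (- r) X p t Hsol Hr Ht).
  rewrite <- (invariant_constant a s X p t Hsol Hs Ht) in Hinv.
  unfold invariant in *. rewrite (char_fun_root _ _ Hs) in Hinv.
  rewrite (char_fun_root _ _ Hr), Ropp_involutive.
  assert (HX := ds_continuous _ _ _ Hsol).
  assert (Hsplit : forall u, kernel r s (t - u) * (exp (r * u) * X u) =
    r ^ 2 * (exp (r * u) * X u) - s ^ 2 * exp ((r + s) * t) * (exp (- s * u) * X u)).
  { intros u. unfold kernel.
    assert (He : exp ((r + s) * (t - u)) * exp (r * u)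
                 = exp ((r + s) * t) * exp (- s * u))
      by (rewrite <- !exp_plus; f_equal; ring).
    replace ((r ^ 2 - s ^ 2 * exp ((r + s) * (t - u))) * (exp (r * u) * X u))
      with (r ^ 2 * (exp (r * u) * X u)
            - s ^ 2 * (exp ((r + s) * (t - u)) * exp (r * u)) * X u) by ring.
    rewrite He. ring. }
  rewrite (RInt_ext _ _ _ _ (fun u _ => Hsplit u)).
  rewrite RInt_lin_comb by (intros; apply continuous_exp_weight, HX).
  set (A := RInt (fun u => exp (- s * u) * X u) (t - a) t) in *.
  assert (HA : s ^ 2 * A = - exp (- s * t) * (p t + s * X t)) by lra.
  replace (s ^ 2 * exp ((r + s) * t) * A) with (exp ((r + s) * t) * (s ^ 2 * A)) by ring.
  rewrite HA.
  assert (He : exp ((r + s) * t) * exp (- s * t) = exp (r * t))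
    by (rewrite <- exp_plus; f_equal; ring).
  replace (exp ((r + s) * t) * (- exp (- s * t) * (p t + s * X t)))
    with (- (exp ((r + s) * t) * exp (- s * t)) * (p t + s * X t)) by ring.
  rewrite He. ring.
Qed.

(** [v |-> char_fun a (- v)] is [-1] at [0] and [(2 / a)^2 - exp 2 > 0] at [2 / a],
    so [char_fun a] vanishes somewhere in [(- 2 / a, 0)].  This is where
    [a < 2 / exp 1] enters. *)
Lemma largest_negative_root_bound (a r : R) :
  0 < a < 2 / exp 1 -> is_largest_negative_root a (- r) -> a * r < 2.
Proof.
  intros [Ha Hae] [_ [_ Hmax]].
  set (f := fun v => char_fun a (- v)).
  assert (He := exp_pos 1).
  assert (Hea : exp 1 * a < 2).
  { apply (Rmult_lt_compat_l (exp 1)) in Hae; [|exact He].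
    replace (exp 1 * (2 / exp 1)) with 2 in Hae by (field; lra). exact Hae. }
  assert (H2a : exp 1 < 2 / a).
  { apply (Rmult_lt_reg_r a); [exact Ha|]. unfold Rdiv.
    rewrite Rmult_assoc, Rinv_l; lra. }
  assert (Hf0 : f 0 < 0).
  { unfold f, char_fun. rewrite Ropp_0, Rmult_0_r, exp_0. lra. }
  assert (Hf2 : 0 < f (2 / a)).
  { unfold f, char_fun. replace (- a * - (2 / a)) with (1 + 1) by (field; lra).
    rewrite exp_plus.
    assert (exp 1 * exp 1 < 2 / a * (2 / a)) by (apply Rmult_le_0_lt_compat; lra).
    lra. }
  destruct (IVT f 0 (2 / a)) as [z [Hz Hfz]]; [|lra|assumption|assumption|].
  - intros v. apply continuity_pt_filterlim.
    apply (ex_derive_continuous (V := R_NormedModule)). unfold f, char_fun.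
    auto_derive. trivial.
  - assert (Hz0 : z <> 0) by (intros ->; lra).
    assert (Hz2 : z <> 2 / a) by (intros ->; lra).
    specialize (Hmax (- z) ltac:(lra) Hfz).
    replace 2 with (a * (2 / a)) by (field; lra).
    apply Rmult_lt_compat_l; lra.
Qed.

Lemma Derive_char_fun (a lam : R) :
  char_fun a lam = 0 -> Derive (char_fun a) lam = lam * (2 + a * lam).
Proof.
  intros H. apply char_fun_root in H. apply is_derive_unique. unfold char_fun.
  auto_derive; [trivial|]. rewrite H. ring.
Qed.

(** * Positive decreasing solutions *)

Lemma weighted_window_pos (a l t : R) (X : R -> R) :
  0 < a -> (forall u, continuous X u) -> (forall u, t - a <= u <= t -> 0 < X u) ->
  0 < RInt (fun u => exp (l * u) * X u) (t - a) t.
Proof.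
  intros Ha HX Hpos. apply RInt_gt_0; [lra| |].
  - intros u Hu. apply Rmult_lt_0_compat; [apply exp_pos | apply Hpos; lra].
  - intros u _. apply continuous_exp_weight, HX.
Qed.

Lemma decreasing_bounded (a : R) (X p : R -> R) :
  0 < a -> delay_solution a X p ->
  (forall t, 0 <= t -> p t < 0) ->
  exists B, forall t, - a <= t -> X t <= B.
Proof.
  intros Ha Hsol Hp.
  destruct (continuity_ab_maj X (- a) 0) as [v [Hv _]];
    [lra | intros; apply continuity_pt_filterlim, (ds_continuous _ _ _ Hsol) |].
  exists (X v). intros t Ht. destruct (Rle_lt_dec t 0) as [H|H]; [now apply Hv|].
  apply Rle_trans with (X 0); [|apply Hv; lra].
  destruct (MVT_gen X 0 t p) as [c [Hc E]].
  - rewrite Rmin_left, Rmax_right by lra. intros u Hu.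
    apply (ds_velocity _ _ _ Hsol). lra.
  - intros u _. apply continuity_pt_filterlim, (ds_continuous _ _ _ Hsol).
  - rewrite Rmin_left, Rmax_right in Hc by lra.
    assert (p c * t <= 0) by (apply Rmult_le_0_r; [apply Rlt_le, Hp|]; lra).
    lra.
Qed.

(** A nonzero value [k] would make the functional [exp (s * t) * k] unbounded.  For
    [k > 0] this is impossible because [p < 0] and [X] is bounded; for [k < 0] the
    positive terms of the functional can only push the velocity lower, so
    [p <= k] and [X] reaches [0]. *)
Lemma invariant_zero_of_decreasing (a s : R) (X p : R -> R) :
  0 < a -> 0 < s -> char_fun a s = 0 -> delay_solution a X p ->
  (forall t, - a <= t -> 0 < X t) -> (forall t, 0 <= t -> p t < 0) ->
  invariant a s X p 0 = 0.
Proof.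
  intros Ha Hs Hroot Hsol HXpos Hp.
  assert (HX := ds_continuous _ _ _ Hsol).
  destruct (decreasing_bounded a X p Ha Hsol Hp) as [B HB].
  set (k := invariant a s X p 0).
  assert (Hk : forall t, 0 <= t ->
     k = exp (- s * t) * (p t + s * X t)
         + s ^ 2 * RInt (fun u => exp (- s * u) * X u) (t - a) t).
  { intros t Ht. unfold k. rewrite <- (invariant_constant a s X p t Hsol Hroot Ht).
    unfold invariant. now rewrite (char_fun_root _ _ Hroot). }
  assert (HB0 : 0 < B) by (apply Rlt_le_trans with (X 0); [apply HXpos | apply HB]; lra).
  assert (Hs2 : 0 < s ^ 2) by now apply pow_lt.
  apply Rle_antisym; apply Rnot_lt_le; intros Hk0.
  (* [C] bounds [exp (s * t)] times the invariant; [exp (s * a)] is the largest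
     weight [exp (s * (t - u))] in the window. *)
  - set (C := s * B + s ^ 2 * (a * (exp (s * a) * B))).
    assert (HC : 0 < C).
    { assert (0 < s * B) by now apply Rmult_lt_0_compat.
      assert (0 < s ^ 2 * (a * (exp (s * a) * B)));
        [apply Rmult_lt_0_compat; [exact Hs2|] | unfold C; lra].
      apply Rmult_lt_0_compat; [exact Ha|].
      apply Rmult_lt_0_compat; [apply exp_pos | exact HB0]. }
    (* Here [k * exp (s * t) >= k * (1 + s * t) = k + C]. *)
    set (t := C / (k * s)).
    assert (Ht : 0 <= t).
    { apply Rlt_le, Rdiv_lt_0_compat; [exact HC|]. now apply Rmult_lt_0_compat. }
    assert (Hint : RInt (fun u => exp (- s * u) * X u) (t - a) t
                   <= a * (exp (- s * t) * exp (s * a) * B)).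
    { replace (a * (exp (- s * t) * exp (s * a) * B))
        with (RInt (fun _ : R => exp (- s * t) * exp (s * a) * B) (t - a) t).
      - apply RInt_le; [lra| | |].
        + apply ex_RInt_of_continuous. intros; apply continuous_exp_weight, HX.
        + apply ex_RInt_const.
        + intros u Hu. rewrite <- exp_plus.
          apply Rmult_le_compat;
            [apply Rlt_le, exp_pos | apply Rlt_le, HXpos; lra | | apply HB; lra].
          apply Rlt_le, exp_increasing.
          assert (0 < s * (a - (t - u))) by (apply Rmult_lt_0_compat; lra). lra.
      - rewrite RInt_const. unfold scal; simpl; unfold mult; simpl. ring. }
    assert (Hupper : k <= exp (- s * t) * C).
    { rewrite (Hk t Ht). unfold C.
      apply (Rmult_le_compat_l (s ^ 2)) in Hint; [|lra].
      assert (exp (- s * t) * (p t + s * X t) <= exp (- s * t) * (s * B)); [|lra].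
      apply Rmult_le_compat_l; [apply Rlt_le, exp_pos|].
      specialize (Hp t Ht).
      assert (s * X t <= s * B) by (apply Rmult_le_compat_l; [|apply HB]; lra). lra. }
    apply (Rmult_le_compat_l (exp (s * t))) in Hupper; [|apply Rlt_le, exp_pos].
    rewrite <- Rmult_assoc, <- exp_plus in Hupper.
    replace (s * t + - s * t) with 0 in Hupper by ring.
    rewrite exp_0, Rmult_1_l in Hupper.
    assert (Hge := exp_ineq1_le (s * t)).
    apply (Rmult_le_compat_r k) in Hge; [|lra].
    replace ((1 + s * t) * k) with (k + C) in Hge by (unfold t; field; lra).
    lra.
  (* [t] is the time at which the line [X 0 + k * t] reaches [0]. *)
  - set (t := X 0 / - k).
    assert (Ht : 0 < t) by (apply Rdiv_lt_0_compat; [apply HXpos|]; lra).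
    destruct (MVT_gen X 0 t p) as [c [Hc E]].
    + rewrite Rmin_left, Rmax_right by lra. intros u Hu.
      apply (ds_velocity _ _ _ Hsol). lra.
    + intros u _. apply continuity_pt_filterlim, HX.
    + rewrite Rmin_left, Rmax_right in Hc by lra.
      assert (Hpc : p c <= k).
      { assert (HW : 0 < RInt (fun u => exp (- s * u) * X u) (c - a) c).
        { apply weighted_window_pos; [exact Ha | exact HX |].
          intros u Hu. apply HXpos; lra. }
        assert (Hpk := Hk c ltac:(lra)).
        apply (Rmult_lt_compat_l (s ^ 2)) in HW; [|exact Hs2].
        assert (HsX : 0 < s * X c) by (apply Rmult_lt_0_compat; [|apply HXpos]; lra).
        assert (He : 0 < exp (- s * c) <= 1).
        { split; [apply exp_pos|]. rewrite <- exp_0.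
          apply Rnot_lt_le. intros H. apply exp_lt_inv in H.
          assert (0 <= s * c) by (apply Rmult_le_pos; lra). lra. }
        assert (0 < exp (- s * c) * (s * X c)) by now apply Rmult_lt_0_compat.
        assert (0 <= (1 - exp (- s * c)) * (- p c)).
        { specialize (Hp c ltac:(lra)). apply Rmult_le_pos; lra. }
        lra. }
      assert (p c * t <= k * t) by (apply Rmult_le_compat_r; lra).
      assert (k * t = - X 0) by (unfold t; field; lra).
      assert (HXt := HXpos t ltac:(lra)). lra.
Qed.

Lemma delay_solution_positive_decreasing (a r s : R) (X p : R -> R) :
  0 < a -> 0 < s -> 0 < r -> a * r < 2 ->
  char_fun a s = 0 -> char_fun a (- r) = 0 ->
  delay_solution a X p -> (forall t, - a <= t <= 0 -> 0 < X t) ->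
  (invariant a s X p 0 = 0 /\ invariant a (- r) X p 0 <= 0) <->
  (forall t, 0 <= t -> 0 < X t /\ p t < 0).
Proof.
  intros Ha Hs Hr Har Hcs Hcr Hsol Hhist.
  assert (HX := ds_continuous _ _ _ Hsol).
  assert (Hy : forall u, continuous (fun u => exp (r * u) * X u) u)
    by (intros; apply continuous_exp_weight, HX).
  assert (Hker : forall v, 0 < v < a -> 0 < kernel r s v)
    by (intros v Hv; apply (kernel_pos a); tauto || lra).
  split.
  - intros [HJs HJr].
    assert (HXpos : forall t, 0 <= t -> 0 < X t).
    { intros t Ht. apply (Rmult_lt_reg_l (exp (r * t))); [apply exp_pos|].
      rewrite Rmult_0_r. revert t Ht.
      apply (renewal_positive a (r + s) (- invariant a (- r) X p 0) (kernel r s));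
        [exact Ha | lra | apply continuous_kernel | exact Hker | exact Hy | |].
      - intros t Ht. apply Rmult_lt_0_compat; [apply exp_pos | now apply Hhist].
      - intros t Ht. now apply renewal_equation. }
    intros t Ht. split; [now apply HXpos|].
    rewrite <- (invariant_constant a s X p t Hsol Hcs Ht) in HJs.
    unfold invariant in HJs.
    assert (HW : 0 < RInt (fun u => exp (- s * u) * X u) (t - a) t).
    { apply weighted_window_pos; [exact Ha | exact HX |]. intros u Hu.
      destruct (Rle_lt_dec 0 u); [apply HXpos | apply Hhist]; lra. }
    apply (Rmult_lt_compat_l (exp (- a * s))) in HW; [|apply exp_pos].
    assert (HsX : 0 < s * X t) by (apply Rmult_lt_0_compat; [|apply HXpos]; lra).
    assert (exp (- s * t) * (p t + s * X t) < exp (- s * t) * 0) by lra.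
    apply Rmult_lt_reg_l in H; [lra | apply exp_pos].
  - intros Hdec.
    assert (HXpos : forall t, - a <= t -> 0 < X t).
    { intros t Ht. destruct (Rle_lt_dec 0 t); [apply Hdec | apply Hhist]; lra. }
    assert (HJs : invariant a s X p 0 = 0).
    { apply invariant_zero_of_decreasing; auto. apply Hdec. }
    split; [exact HJs|]. apply Rnot_lt_le. intros HJr.
    apply (renewal_not_positive a (r + s) (invariant a (- r) X p 0) (kernel r s)
             (fun u => exp (r * u) * X u)).
    + exact Ha.
    + lra.
    + exact HJr.
    + apply continuous_kernel.
    + intros v Hv. now apply Rlt_le, Hker.
    + rewrite RInt_kernel by assumption.
      assert (r * (a * r) <= r * 2) by (apply Rmult_le_compat_l; lra). lra.
    + exact Hy.
    + intros t Ht. now apply renewal_equation.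
    + intros t Ht. apply Rmult_lt_0_compat; [apply exp_pos | now apply Hdec].
Qed.

Theorem theorem3p4 :
  forall (a s r : R) (x : R -> R),
    0 < a < 2 / exp 1 ->
    is_positive_root a s ->
    is_largest_negative_root a (- r) ->
    is_solution a x ->
    C1_on (fun t => - a <= t <= 0) x ->
    (forall t, - a <= t <= 0 -> 0 < x t) ->
    let c0 := J_fun a s x 0 / Derive (char_fun a) s in
    let c1 := J_fun a (- r) x 0 / Derive (char_fun a) (- r) in
    (c0 = 0 /\ 0 <= c1) <->
    (forall t, 0 <= t -> 0 < x t /\ Derive x t < 0).
Proof.
  intros a s r x Ha [Hs Hcs] Hroot Hsol _ Hhist.
  assert (Har := largest_negative_root_bound a r Ha Hroot).
  destruct Hroot as [Hr [Hcr _]], Ha as [Ha _].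
  assert (Hcore : (J_fun a s x 0 = 0 /\ J_fun a (- r) x 0 <= 0) <->
            (forall t, 0 <= t -> 0 < x t /\ Derive x t < 0)).
  { rewrite !J_fun_invariant by exact Ha.
    rewrite (delay_solution_positive_decreasing a r s); try assumption; try lra.
    - split; intros H t Ht; specialize (H t Ht).
      + rewrite Rmax_right in H by lra. exact H.
      + rewrite Rmax_right by lra. exact H.
    - now apply delay_solution_clamp.
    - intros t Ht. rewrite Rmax_right by lra. now apply Hhist. }
  cbv zeta. rewrite <- Hcore, !Derive_char_fun by assumption.
  set (Js := J_fun a s x 0). set (Jr := J_fun a (- r) x 0).
  assert (Has : 0 < a * s) by now apply Rmult_lt_0_compat.
  assert (Hdr : 0 < r * (2 - a * r)) by (apply Rmult_lt_0_compat; lra).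
  assert (Es : Js = Js / (s * (2 + a * s)) * (s * (2 + a * s))) by (field; lra).
  replace (- r * (2 + a * - r)) with (- (r * (2 - a * r))) by ring.
  assert (Er : Jr / - (r * (2 - a * r)) = - Jr * / (r * (2 - a * r))) by (field; lra).
  rewrite Er. split; intros [H0 H1]; split.
  - rewrite Es, H0. ring.
  - apply Rnot_lt_le. intros H.
    assert (0 < Jr * / (r * (2 - a * r))); [|lra].
    apply Rmult_lt_0_compat; [exact H | now apply Rinv_0_lt_compat].
  - rewrite H0. field. lra.
  - apply Rmult_le_pos; [lra|]. now apply Rlt_le, Rinv_0_lt_compat.
Qed.
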